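(* Let $A$ be a unital algebra with differential graded algebra $(\Omega,\mathrm d)$ and let $(\nabla,\sigma)$ be a torsion free bimodule connection on $\Omega^1$. Let $\mathcal J^2_A=A\oplus\Omega^1\oplus\Omega^2_S$ with left and right actions of $a\in A$ \begin{align*} a\bullet_2s&=as+(\mathrm da)s+(\nabla\mathrm da)s, & s\bullet_2a&=sa+s\,\mathrm da+s\nabla\mathrm da,\\ a\bullet_2\omega&=a\omega+[2,\sigma](\mathrm da\otimes\omega), & \omega\bullet_2a&=\omega a+[2,\sigma](\omega\otimes\mathrm da),\\ a\bullet_2(\omega^1\otimes\omega^2)&=a\omega^1\otimes\omega^2, & (\omega^1\otimes\omega^2)\bullet_2a&=\omega^1\otimes\omega^2a \end{align*} for $s\in A$, $\omega\in\Omega^1$, $\omega^1\otimes\omega^2\in\Omega^2_S$, and let $j^2(s)=s+\mathrm ds+\nabla\mathrm ds$. Then $\mathcal J^2_A$ is an $A$-bimodule and $j^2:A\to\mathcal J^2_A$ is a bimodule map. Moreover, the map $\pi_2:\mathcal J^2_A\to\mathcal J^1_A$ given by quotienting out $\Omega^2_S$ is a bimodule surjection with $\pi_2\circ j^2=j^1$.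
   Context: Everything is over a field. $A$ is a unital algebra and $(\Omega=\oplus_n\Omega^n,\mathrm d)$ is a differential graded algebra with $\Omega^0=A$, product $\wedge$, $\mathrm d$ of degree $1$ with $\mathrm d^2=0$ and the graded Leibniz rule, and $\Omega$ generated by $A,\mathrm dA$. Tensor products of bimodules are over $A$. A bimodule connection $(\nabla,\sigma)$ on $\Omega^1$ is a linear map $\nabla:\Omega^1\to\Omega^1\otimes_A\Omega^1$ and a bimodule map $\sigma:\Omega^1\otimes_A\Omega^1\to\Omega^1\otimes_A\Omega^1$ with $\nabla(a\omega)=\mathrm da\otimes\omega+a\nabla\omega$, $\nabla(\omega a)=(\nabla\omega)a+\sigma(\omega\otimes\mathrm da)$. It is torsion free if $\wedge\circ\nabla=\mathrm d$ on $\Omega^1$. $\Omega^2_S=\ker\big(\wedge:\Omega^1\otimes_A\Omega^1\to\Omega^2\big)$ and $[2,\sigma]=\mathrm{id}+\sigma$. The algebra $A$ is a bimodule over itself by multiplication. $\mathcal J^1_A=A\oplus\Omega^1$ with $j^1(s)=s+\mathrm ds$ and bimodule structure $a\bullet_1s=as+(\mathrm da)s$, $s\bullet_1a=sa+s\,\mathrm da$, $a\bullet_1\omega=a\omega$, $\omega\bullet_1a=\omega a$. *)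

(* Defs.v *)
From HB Require Import structures.
From mathcomp Require Import all_boot all_algebra.
From mathcomp Require Import boolp.

Set Implicit Arguments.
Unset Strict Implicit.
Unset Printing Implicit Defensive.

Import GRing.Theory.
Local Open Scope ring_scope.
Local Open Scope quotient_scope.

(* k-bilinearity of the two actions makes k act centrally:                    *)
(* (c *: 1) v = c *: v = v (c *: 1).                                          *)
Record bimodule (k : fieldType) (A : algType k) (M : lmodType k) := Bimodule {
  lact : A -> M -> M;
  ract : M -> A -> M;
  lact_linearl : forall m, linear (lact^~ m);
  lact_linearr : forall a, linear (lact a);
  ract_linearl : forall a, linear (ract^~ a);
  ract_linearr : forall m, linear (ract m);
  lact1 : forall m, lact 1 m = m;
  ract1 : forall m, ract m 1 = m;
  lactM : forall a b m, lact (a * b) m = lact a (lact b m);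
  ractM : forall m a b, ract m (a * b) = ract (ract m a) b;
  lractA : forall a m b, lact a (ract m b) = ract (lact a m) b
}.

Definition bimod_map (k : fieldType) (A : algType k) (M N : lmodType k)
    (BM : bimodule A M) (BN : bimodule A N) (f : M -> N) : Prop :=
  [/\ linear f,
      forall a m, f (lact BM a m) = lact BN a (f m)
    & forall m a, f (ract BM m a) = ract BN (f m) a].

Section Regular.
Variables (k : fieldType) (A : algType k).

Fact reg_linearl (m : A) : linear (fun a : A => a * m).
Proof. by move=> c a b; rewrite mulrDl scalerAl. Qed.

Fact reg_linearr (m : A) : linear (fun a : A => m * a).
Proof. by move=> c a b; rewrite mulrDr scalerAr. Qed.

Definition reg_bimod : bimodule A A :=
  @Bimodule k A A (fun a m => a * m) (fun m a => m * a)
    reg_linearl reg_linearr reg_linearl reg_linearr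
    (@mul1r A) (@mulr1 A)
    (fun a b m => esym (mulrA a b m)) (@mulrA A) (@mulrA A).

End Regular.

(* M (x)_A N is the abelian group of formal sums of pairs (m, n), modulo the  *)
(* congruence generated by biadditivity and A-balancedness. The formal sum    *)
(* of the (m_i, n_i) is the sequence of these pairs, addition is              *)
(* concatenation; scalars and opposites go through the left factor, where     *)
(* centrality of k makes this the usual k-structure.                          *)
Section Tensor.
Variables (k : fieldType) (A : algType k) (M N : lmodType k).
Variables (BM : bimodule A M) (BN : bimodule A N).

Inductive teq : seq (M * N) -> seq (M * N) -> Prop :=
| teq_refl s : teq s s
| teq_sym s t : teq s t -> teq t s
| teq_trans s t u : teq s t -> teq t u -> teq s u
| teq_cat s s' t t' : teq s s' -> teq t t' -> teq (s ++ t) (s' ++ t')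
| teq_catC s t : teq (s ++ t) (t ++ s)
| teq_0l n : teq [:: (0, n)] [::]
| teq_Dl m m' n : teq [:: (m + m', n)] [:: (m, n); (m', n)]
| teq_Dr m n n' : teq [:: (m, n + n')] [:: (m, n); (m, n')]
| teq_bal m a n : teq [:: (ract BM m a, n)] [:: (m, lact BN a n)].

Definition teqb : rel (seq (M * N)) := fun s t => `[< teq s t >].

Fact teqb_refl : reflexive teqb.
Proof. by move=> s; apply/asboolP; exact: teq_refl. Qed.

Fact teqb_sym : symmetric teqb.
Proof. by move=> s t; apply/asboolP/asboolP; exact: teq_sym. Qed.

Fact teqb_trans : transitive teqb.
Proof.
move=> t s u /asboolP st /asboolP tu.
by apply/asboolP; exact: teq_trans st tu.
Qed.

Canonical teq_equiv := EquivRel teqb teqb_refl teqb_sym teqb_trans.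

Definition tensor := {eq_quot teq_equiv}.
HB.instance Definition _ := Choice.on tensor.

Definition tsum (s : seq (M * N)) : tensor := \pi_({eq_quot teq_equiv}) s.

Fact tsumP s t : tsum s = tsum t <-> teq s t.
Proof.
split=> [/eqP st|st]; last by apply/eqP; rewrite /tsum eqmodE; exact/asboolP.
by apply/asboolP; move: st; rewrite /tsum eqmodE.
Qed.

Fact tsum_ind (P : tensor -> Prop) : (forall s, P (tsum s)) -> forall x, P x.
Proof. by move=> Ps x; rewrite -[x]reprK; exact: Ps. Qed.

(* Induced map of a map of pairs respecting the relations (cf. tmapE).        *)
Definition tmap (f : M * N -> M * N) (x : tensor) : tensor :=
  tsum (map f (repr x)).

Definition tcompat (f : M * N -> M * N) :=
  [/\ forall n, teq [:: f (0, n)] [::],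
      forall m m' n, teq [:: f (m + m', n)] [:: f (m, n); f (m', n)],
      forall m n n', teq [:: f (m, n + n')] [:: f (m, n); f (m, n')]
    & forall m a n, teq [:: f (ract BM m a, n)] [:: f (m, lact BN a n)]].

Fact teq_map f : tcompat f ->
  forall s t, teq s t -> teq (map f s) (map f t).
Proof.
case=> f0 fDl fDr fb s t; elim=> {s t} /=; rewrite ?map_cat.
- by move=> s; exact: teq_refl.
- by move=> s t _; exact: teq_sym.
- by move=> s t u _ st _; exact: teq_trans.
- by move=> s s' t t' _ ss' _ tt'; rewrite !map_cat; exact: teq_cat.
- by move=> s t; rewrite !map_cat; exact: teq_catC.
- by move=> n; exact: f0.
- by move=> m m' n; exact: fDl.
- by move=> m n n'; exact: fDr.
- by move=> m a n; exact: fb.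
Qed.

Fact tmapE f : tcompat f -> forall s, tmap f (tsum s) = tsum (map f s).
Proof.
move=> fc s; apply/tsumP; apply: teq_map => //.
by apply/tsumP; rewrite /tsum reprK.
Qed.

Definition tadd (x y : tensor) : tensor := tsum (repr x ++ repr y).

Fact taddE s t : tadd (tsum s) (tsum t) = tsum (s ++ t).
Proof. by apply/tsumP/teq_cat; apply/tsumP; rewrite /tsum reprK. Qed.

Definition tscale_pair (c : k) (p : M * N) := (c *: p.1, p.2).

Fact lin0 (V W : lmodType k) (f : V -> W) : linear f -> f 0 = 0.
Proof. by move=> fl; have /= := fl (-1) 0 0; rewrite !scaleN1r addr0 oppr0 addNr. Qed.

Fact linD (V W : lmodType k) (f : V -> W) : linear f -> {morph f : x y / x + y}.
Proof. by move=> fl x y; rewrite -[x]scale1r fl !scale1r. Qed.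

Fact linZ (V W : lmodType k) (f : V -> W) : linear f ->
  forall c x, f (c *: x) = c *: f x.
Proof. by move=> fl c x; rewrite -[c *: x]addr0 fl (lin0 fl) addr0. Qed.

Fact tscale_compat c : tcompat (tscale_pair c).
Proof.
rewrite /tscale_pair; split=> /=.
- by move=> n; rewrite scaler0; exact: teq_0l.
- by move=> m m' n; rewrite scalerDr; exact: teq_Dl.
- by move=> m n n'; exact: teq_Dr.
- move=> m a n; rewrite -(linZ (ract_linearl BM a)); exact: teq_bal.
Qed.

Definition tscale (c : k) : tensor -> tensor := tmap (tscale_pair c).

Fact tscaleE c s : tscale c (tsum s) = tsum (map (tscale_pair c) s).
Proof. exact/tmapE/tscale_compat. Qed.

Fact taddA : associative tadd.
Proof. by do 3!elim/tsum_ind=> ?; rewrite !taddE catA. Qed.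

Fact taddC : commutative tadd.
Proof. by do 2!elim/tsum_ind=> ?; rewrite !taddE; exact/tsumP/teq_catC. Qed.

Fact tadd0 : left_id (tsum [::]) tadd.
Proof. by elim/tsum_ind=> s; rewrite taddE. Qed.

Fact tscaleDl x : {morph tscale^~ x : a b / a + b >-> tadd a b}.
Proof.
elim/tsum_ind: x => s a b; rewrite !tscaleE taddE; apply/tsumP.
elim: s => [|[m n] s IH]; first exact: teq_refl.
rewrite -[map _ (_ :: s)]/([:: ((a + b) *: m, n)] ++ map _ s) scalerDl.
apply: teq_trans (teq_cat (teq_Dl _ _ _) IH) _.
set u := map _ s; set v := map _ s.
rewrite -[X in teq X _]/([:: (a *: m, n)] ++ ([:: (b *: m, n)] ++ (u ++ v))).
rewrite -[X in teq _ X]/([:: (a *: m, n)] ++ (u ++ ([:: (b *: m, n)] ++ v))).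
apply: teq_cat (teq_refl _) _; rewrite !catA.
exact: teq_cat (teq_catC _ _) (teq_refl _).
Qed.

Fact taddN : left_inverse (tsum [::]) (tscale (-1)) tadd.
Proof.
elim/tsum_ind=> s; rewrite -[X in tadd _ X](_ : tscale 1 (tsum s) = _).
  rewrite -tscaleDl addNr tscaleE; apply/tsumP.
  elim: s => [|[m n] s IH]; first exact: teq_refl.
  rewrite /= /tscale_pair /= scale0r; exact: (teq_cat (teq_0l n) IH).
rewrite tscaleE; congr tsum; rewrite -[RHS]map_id; apply: eq_map => -[m n].
by rewrite /tscale_pair scale1r.
Qed.

HB.instance Definition _ := GRing.isZmodule.Build tensor taddA taddC tadd0 taddN.

Fact tscaleA a b x : tscale a (tscale b x) = tscale (a * b) x.
Proof.
elim/tsum_ind: x => s; rewrite !tscaleE -map_comp; congr tsum.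
by apply: eq_map => -[m n]; rewrite /tscale_pair /= scalerA.
Qed.

Fact tscale1 : left_id 1 tscale.
Proof.
elim/tsum_ind=> s; rewrite tscaleE; congr tsum; rewrite -[RHS]map_id.
by apply: eq_map => -[m n]; rewrite /tscale_pair scale1r.
Qed.

Fact tscaleDr : right_distributive tscale +%R.
Proof.
by move=> c; do 2!elim/tsum_ind=> ?; rewrite [_ + _]taddE !tscaleE map_cat -taddE.
Qed.

HB.instance Definition _ :=
  GRing.Zmodule_isLmodule.Build k tensor tscaleA tscale1 tscaleDr tscaleDl.

Definition tens (m : M) (n : N) : tensor := tsum [:: (m, n)].

(* For balanced f, the unique linear map m (x) n |-> f m n: see tlift_tens and *)
(* tlift_linear.                                                              *)
Definition tlift (V : lmodType k) (f : M -> N -> V) (x : tensor) : V :=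
  \sum_(p <- repr x) f p.1 p.2.

Definition balanced (V : lmodType k) (f : M -> N -> V) :=
  [/\ forall n, linear (f^~ n), forall m, linear (f m)
    & forall m a n, f (ract BM m a) n = f m (lact BN a n)].

Fact tliftE (V : lmodType k) (f : M -> N -> V) : balanced f ->
  forall s, tlift f (tsum s) = \sum_(p <- s) f p.1 p.2.
Proof.
case=> fl fr fb s.
suff sumE s' t : teq s' t -> \sum_(p <- s') f p.1 p.2 = \sum_(p <- t) f p.1 p.2.
  by apply: sumE; apply/tsumP; rewrite /tsum reprK.
elim=> {s s' t} //.
- by move=> s t u _ -> _ ->.
- by move=> s s' t t' _ e _ e'; rewrite !big_cat /= e e'.
- by move=> s t; rewrite !big_cat /= addrC.
- by move=> n; rewrite big_seq1 big_nil /= (lin0 (fl n)).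
- by move=> m m' n; rewrite big_seq1 big_cons big_seq1 /= (linD (fl n)).
- by move=> m n n'; rewrite big_seq1 big_cons big_seq1 /= (linD (fr m)).
- by move=> m a n; rewrite !big_seq1 /= fb.
Qed.

Fact tlift_tens (V : lmodType k) (f : M -> N -> V) : balanced f ->
  forall m n, tlift f (tens m n) = f m n.
Proof. by move=> fb m n; rewrite tliftE // big_seq1. Qed.

Fact tlift_linear (V : lmodType k) (f : M -> N -> V) :
  balanced f -> linear (tlift f).
Proof.
move=> fb c x y; elim/tsum_ind: x => s; elim/tsum_ind: y => t.
rewrite [c *: _]tscaleE [_ + _]taddE !tliftE // big_cat big_map scaler_sumr /=.
by congr (_ + _); apply: eq_bigr => p _; case: fb => fl _ _; rewrite (linZ (fl _)).
Qed.

Definition tlact (a : A) : tensor -> tensor :=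
  tmap (fun p => (lact BM a p.1, p.2)).

Definition tract (x : tensor) (a : A) : tensor :=
  tmap (fun p => (p.1, ract BN p.2 a)) x.

Fact tlact_compat a : tcompat (fun p => (lact BM a p.1, p.2)).
Proof.
split=> /=.
- by move=> n; rewrite (lin0 (lact_linearr BM a)); exact: teq_0l.
- by move=> m m' n; rewrite (linD (lact_linearr BM a)); exact: teq_Dl.
- by move=> m n n'; exact: teq_Dr.
- by move=> m b n; rewrite lractA; exact: teq_bal.
Qed.

Fact tract_compat a : tcompat (fun p => (p.1, ract BN p.2 a)).
Proof.
split=> /=.
- by move=> n; exact: teq_0l.
- by move=> m m' n; exact: teq_Dl.
- by move=> m n n'; rewrite (linD (ract_linearl BN a)); exact: teq_Dr.
- by move=> m b n; rewrite -lractA; exact: teq_bal.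
Qed.

Fact tlactE a s : tlact a (tsum s) = tsum [seq (lact BM a p.1, p.2) | p <- s].
Proof. exact/tmapE/tlact_compat. Qed.

Fact tractE s a : tract (tsum s) a = tsum [seq (p.1, ract BN p.2 a) | p <- s].
Proof. exact/tmapE/tract_compat. Qed.

Fact tlact_tens a m n : tlact a (tens m n) = tens (lact BM a m) n.
Proof. exact: tlactE. Qed.

Fact tract_tens m n a : tract (tens m n) a = tens m (ract BN n a).
Proof. exact: tractE. Qed.

Fact tsum_cons p s : tsum (p :: s) = tens p.1 p.2 + tsum s.
Proof. by case: p => m n; rewrite [RHS]taddE. Qed.

Fact tens_linearl n : linear (tens^~ n).
Proof.
move=> c m m'; rewrite [c *: tens _ _]tscaleE [RHS]taddE; apply/tsumP.
exact: teq_Dl.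
Qed.

Fact teq_scale c m n : teq [:: (c *: m, n)] [:: (m, c *: n)].
Proof.
rewrite -{1}(ract1 BM m) -{2}(lact1 BN n).
rewrite -(linZ (ract_linearr BM m)) -(linZ (lact_linearl BN n)).
exact: teq_bal.
Qed.

Fact tens_linearr m : linear (tens m).
Proof.
move=> c n n'; rewrite [c *: tens _ _]tscaleE [RHS]taddE; apply/tsumP.
apply: teq_trans (teq_Dr _ _ _) _.
exact: (teq_cat (teq_sym (teq_scale c m n)) (teq_refl [:: (m, n')])).
Qed.

Fact tens_bal m a n : tens (ract BM m a) n = tens m (lact BN a n).
Proof. exact/tsumP/teq_bal. Qed.

Fact tlact_linearr a : linear (tlact a).
Proof.
move=> c; do 2!elim/tsum_ind=> ?.
rewrite [c *: _]tscaleE [_ + _]taddE !tlactE [c *: _]tscaleE [RHS]taddE.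
rewrite map_cat -!map_comp; congr (tsum (_ ++ _)); apply: eq_map => p /=.
by rewrite /tscale_pair /= (linZ (lact_linearr BM a)).
Qed.

Fact tract_linearl a : linear (tract^~ a).
Proof.
move=> c; do 2!elim/tsum_ind=> ?.
rewrite [c *: _]tscaleE [_ + _]taddE !tractE [c *: _]tscaleE [RHS]taddE.
by rewrite map_cat -!map_comp.
Qed.

Fact tlact_linearl x : linear (tlact^~ x).
Proof.
move=> c a b; elim/tsum_ind: x => s; elim: s => [|p s IH].
  by rewrite !tlactE -[tsum _]/(0 : tensor) scaler0 addr0.
rewrite tsum_cons !(linD (tlact_linearr _)) {}IH !tlact_tens.
rewrite (lact_linearl BM) tens_linearl scalerDr -!addrA; congr (_ + _).
by rewrite addrCA.
Qed.

Fact tract_linearr x : linear (tract x).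
Proof.
move=> c a b; elim/tsum_ind: x => s; elim: s => [|p s IH].
  by rewrite !tractE -[tsum _]/(0 : tensor) scaler0 addr0.
rewrite tsum_cons !(linD (tract_linearl _)) {}IH !tract_tens.
rewrite (ract_linearr BN) tens_linearr scalerDr -!addrA; congr (_ + _).
by rewrite addrCA.
Qed.

Fact tlact1 x : tlact 1 x = x.
Proof.
elim/tsum_ind: x => s; rewrite tlactE -[in RHS](map_id s); congr tsum.
by apply: eq_map => -[m n]; rewrite lact1.
Qed.

Fact tract1 x : tract x 1 = x.
Proof.
elim/tsum_ind: x => s; rewrite tractE -[in RHS](map_id s); congr tsum.
by apply: eq_map => -[m n]; rewrite ract1.
Qed.

Fact tlactM a b x : tlact (a * b) x = tlact a (tlact b x).
Proof.
elim/tsum_ind: x => s; rewrite !tlactE -map_comp; congr tsum.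
by apply: eq_map => p; rewrite lactM.
Qed.

Fact tractM x a b : tract x (a * b) = tract (tract x a) b.
Proof.
elim/tsum_ind: x => s; rewrite !tractE -map_comp; congr tsum.
by apply: eq_map => p; rewrite ractM.
Qed.

Fact tlractA a x b : tlact a (tract x b) = tract (tlact a x) b.
Proof.
elim/tsum_ind: x => s.
by rewrite !(tractE, tlactE) -!map_comp.
Qed.

Definition tensor_bimod : bimodule A tensor :=
  Bimodule tlact_linearl tlact_linearr tract_linearl tract_linearr
    tlact1 tract1 tlactM tractM tlractA.

End Tensor.

(* Degree 0 is A itself; P n is the component of degree n.+1.                 *)
Definition forms (k : fieldType) (A : algType k) (P : nat -> lmodType k)
    (n : nat) : lmodType k := if n is m.+1 then P m else A.

Record dga (k : fieldType) (A : algType k) := DGA {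
  pos_form : nat -> lmodType k;
  form := forms A pos_form;
  wedge : forall m n, form m -> form n -> form (m + n);
  ext_d : forall n, {linear form n -> form n.+1};
  wedge_linearl : forall m n (y : form n), linear (fun x : form m => wedge x y);
  wedge_linearr : forall m n (x : form m), linear (fun y : form n => wedge x y);
  wedge00 : forall a b : A, @wedge 0 0 a b = a * b;
  wedge1x : forall n (x : form n), @wedge 0 n (1 : A) x = x;
  wedgex1 : forall n (x : form n),
    ecast i (form i) (addn0 n) (@wedge n 0 x (1 : A)) = x;
  wedgeA : forall m n p (x : form m) (y : form n) (z : form p),
    ecast i (form i) (addnA m n p) (wedge x (wedge y z)) =
    wedge (wedge x y) z;
  ext_dd : forall n (x : form n), ext_d n.+1 (ext_d n x) = 0;
  leibniz : forall m n (x : form m) (y : form n),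
    ext_d (m + n) (wedge x y) =
    wedge (ext_d m x) y
    + (-1) ^+ m *: ecast i (form i) (addnS m n) (wedge x (ext_d n y));
  (* The generators A and dA are homogeneous, so graded subalgebras suffice.  *)
  form_generated : forall S : (forall n, form n -> Prop),
    (forall n, S n 0) ->
    (forall n c (x y : form n), S n x -> S n y -> S n (c *: x + y)) ->
    (forall m n (x : form m) (y : form n),
       S m x -> S n y -> S (m + n)%N (wedge x y)) ->
    (forall a : A, S 0%N a /\ S 1%N (ext_d 0 a)) ->
    forall n (x : form n), S n x
}.

(* lmul1 and rmul1 are the actions of A on Omega1; Omega11 is the tensor      *)
(* square of Omega1 over A, and wedgeT the product Omega11 -> Omega2.         *)
Section Forms.
Variables (k : fieldType) (A : algType k) (Om : dga A).

Definition Omega1 : lmodType k := form Om 1.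
Definition Omega2 : lmodType k := form Om 2.

Definition d0 (a : A) : Omega1 := @ext_d k A Om 0 a.
Definition d1 (w : Omega1) : Omega2 := @ext_d k A Om 1 w.

Definition lmul1 (a : A) (w : Omega1) : Omega1 := @wedge k A Om 0 1 a w.
Definition rmul1 (w : Omega1) (a : A) : Omega1 := @wedge k A Om 1 0 w a.
Definition wedge11 (w v : Omega1) : Omega2 := @wedge k A Om 1 1 w v.

Fact lmul1_linearl w : linear (lmul1^~ w).
Proof. exact: (@wedge_linearl k A Om 0 1 w). Qed.
Fact lmul1_linearr a : linear (lmul1 a).
Proof. exact: (@wedge_linearr k A Om 0 1 a). Qed.
Fact rmul1_linearl a : linear (rmul1^~ a).
Proof. exact: (@wedge_linearl k A Om 1 0 a). Qed.
Fact rmul1_linearr w : linear (rmul1 w).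
Proof. exact: (@wedge_linearr k A Om 1 0 w). Qed.

Fact lmul11 w : lmul1 1 w = w.
Proof. exact: (@wedge1x k A Om 1 w). Qed.
Fact rmul11 w : rmul1 w 1 = w.
Proof.
by rewrite -[RHS](@wedgex1 k A Om 1 w) (eq_irrelevance (addn0 1) erefl).
Qed.

Fact lmul1M a b w : lmul1 (a * b) w = lmul1 a (lmul1 b w).
Proof.
have := @wedgeA k A Om 0 0 1 a b w.
by rewrite (eq_irrelevance (addnA 0 0 1) erefl) wedge00 => /esym.
Qed.
Fact rmul1M w a b : rmul1 w (a * b) = rmul1 (rmul1 w a) b.
Proof.
have := @wedgeA k A Om 1 0 0 w a b.
by rewrite (eq_irrelevance (addnA 1 0 0) erefl) wedge00.
Qed.
Fact lrmul1A a w b : lmul1 a (rmul1 w b) = rmul1 (lmul1 a w) b.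
Proof.
have := @wedgeA k A Om 0 1 0 a w b.
by rewrite (eq_irrelevance (addnA 0 1 0) erefl).
Qed.

Definition Omega1_bimod : bimodule A Omega1 :=
  Bimodule lmul1_linearl lmul1_linearr rmul1_linearl rmul1_linearr
    lmul11 rmul11 lmul1M rmul1M lrmul1A.

Definition Omega11 : lmodType k := tensor Omega1_bimod Omega1_bimod.
Definition Omega11_bimod : bimodule A Omega11 :=
  tensor_bimod Omega1_bimod Omega1_bimod.
Definition tens1 (w v : Omega1) : Omega11 := tens Omega1_bimod Omega1_bimod w v.

Definition wedgeT : Omega11 -> Omega2 :=
  @tlift k A Omega1 Omega1 Omega1_bimod Omega1_bimod Omega2 wedge11.

Fact wedge11_balanced : balanced Omega1_bimod Omega1_bimod wedge11.
Proof.
split.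
- exact: (@wedge_linearl k A Om 1 1).
- exact: (@wedge_linearr k A Om 1 1).
- move=> w a v; have := @wedgeA k A Om 1 0 1 w a v.
  by rewrite (eq_irrelevance (addnA 1 0 1) erefl) => /esym.
Qed.

Fact wedgeT_tens w v : wedgeT (tens1 w v) = wedge11 w v.
Proof. exact/tlift_tens/wedge11_balanced. Qed.

Fact wedgeT_linear : linear wedgeT.
Proof. exact/tlift_linear/wedge11_balanced. Qed.

Definition ker_wedge : {pred Omega11} := [pred x | wedgeT x == 0].

Fact ker_wedge_submod : submod_closed ker_wedge.
Proof.
split=> [|c x y]; rewrite !inE; first by rewrite (lin0 wedgeT_linear).
by move=> /eqP x0 /eqP y0; rewrite wedgeT_linear x0 y0 scaler0 addr0.
Qed.
HB.instance Definition _ := GRing.isSubmodClosed.Build k Omega11 ker_wedge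
  (GRing.submod_closed_semi ker_wedge_submod).

Definition Omega2S := {x : Omega11 | x \in ker_wedge}.
HB.instance Definition _ := SubChoice.on Omega2S.
HB.instance Definition _ := [SubChoice_isSubLmodule of Omega2S by <:].

Record bimod_connection := BimodConnection {
  nabla : {linear Omega1 -> Omega11};
  sigma : Omega11 -> Omega11;
  sigma_bimod_map : bimod_map Omega11_bimod Omega11_bimod sigma;
  nabla_leibnizl : forall a w,
    nabla (lmul1 a w) = tens1 (d0 a) w + lact Omega11_bimod a (nabla w);
  nabla_leibnizr : forall w a,
    nabla (rmul1 w a) = ract Omega11_bimod (nabla w) a + sigma (tens1 w (d0 a))
}.

Definition torsion_free (C : bimod_connection) : Prop :=
  forall w, wedgeT (nabla C w) = d1 w.

Definition two_sigma (C : bimod_connection) (x : Omega11) : Omega11 :=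
  x + sigma C x.

Definition jet1 : lmodType k := (A * Omega1)%type.

Definition jet1_lact (a : A) (x : jet1) : jet1 :=
  (a * x.1, rmul1 (d0 a) x.1 + lmul1 a x.2).

Definition jet1_ract (x : jet1) (a : A) : jet1 :=
  (x.1 * a, lmul1 x.1 (d0 a) + rmul1 x.2 a).

Definition j1 (s : A) : jet1 := (s, d0 s).

Fact d0_linear : linear d0.
Proof. exact: (linearP (@ext_d k A Om 0)). Qed.

Fact d0M a b : d0 (a * b) = rmul1 (d0 a) b + lmul1 a (d0 b).
Proof.
have := @leibniz k A Om 0 0 a b.
by rewrite (eq_irrelevance (addnS 0 0) erefl) wedge00 expr0 scale1r.
Qed.

Fact d01 : d0 1 = 0.
Proof.
have := d0M 1 1; rewrite mulr1 rmul11 lmul11 -{1}[d0 1]addr0.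
by move/addrI.
Qed.

Fact jet1_lact_linearl x : linear (jet1_lact^~ x).
Proof.
move=> c a b; congr pair => /=; first exact: reg_linearl.
by rewrite d0_linear rmul1_linearl lmul1_linearl scalerDr addrACA.
Qed.

Fact jet1_lact_linearr a : linear (jet1_lact a).
Proof.
move=> c x y; congr pair => /=; first exact: reg_linearr.
by rewrite rmul1_linearr lmul1_linearr scalerDr addrACA.
Qed.

Fact jet1_ract_linearl a : linear (jet1_ract^~ a).
Proof.
move=> c x y; congr pair => /=; first exact: reg_linearl.
by rewrite lmul1_linearl rmul1_linearl scalerDr addrACA.
Qed.

Fact jet1_ract_linearr x : linear (jet1_ract x).
Proof.
move=> c a b; congr pair => /=; first exact: reg_linearr.
by rewrite d0_linear lmul1_linearr rmul1_linearr scalerDr addrACA.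
Qed.

Fact jet1_lact1 x : jet1_lact 1 x = x.
Proof.
case: x => s w; rewrite /jet1_lact /= mul1r d01 lmul11.
by rewrite (lin0 (rmul1_linearl s)) add0r.
Qed.

Fact jet1_ract1 x : jet1_ract x 1 = x.
Proof.
case: x => s w; rewrite /jet1_ract /= mulr1 d01 rmul11.
by rewrite (lin0 (lmul1_linearr s)) add0r.
Qed.

Fact jet1_lactM a b x : jet1_lact (a * b) x = jet1_lact a (jet1_lact b x).
Proof.
case: x => s w; rewrite /jet1_lact /= mulrA d0M (linD (rmul1_linearl s)).
by rewrite (linD (lmul1_linearr a)) rmul1M lmul1M lrmul1A addrA.
Qed.

Fact jet1_ractM x a b : jet1_ract x (a * b) = jet1_ract (jet1_ract x a) b.
Proof.
case: x => s w; rewrite /jet1_ract /= mulrA d0M (linD (lmul1_linearr s)).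
rewrite (linD (rmul1_linearl b)) rmul1M lmul1M lrmul1A -addrA.
by rewrite addrCA.
Qed.

Fact jet1_lractA a x b :
  jet1_lact a (jet1_ract x b) = jet1_ract (jet1_lact a x) b.
Proof.
case: x => s w; rewrite /jet1_lact /jet1_ract /= mulrA rmul1M lmul1M.
rewrite (linD (lmul1_linearr a)) (linD (rmul1_linearl b)) lrmul1A.
by rewrite addrCA.
Qed.

Definition jet1_bimod : bimodule A jet1 :=
  Bimodule jet1_lact_linearl jet1_lact_linearr
    jet1_ract_linearl jet1_ract_linearr
    jet1_lact1 jet1_ract1 jet1_lactM jet1_ractM jet1_lractA.

Definition jet2 : lmodType k := (A * Omega1 * Omega2S)%type.

Definition jet2_A (s : A) : jet2 := (s, 0, 0).
Definition jet2_Omega1 (w : Omega1) : jet2 := (0, w, 0).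
Definition jet2_Omega2S (t : Omega2S) : jet2 := (0, 0, t).

(* Injective, so an operation into jet2 is determined by its values here.     *)
Definition jet2_ambient (x : jet2) : (A * Omega1 * Omega11)%type :=
  (x.1.1, x.1.2, val x.2).

Definition pi2 (x : jet2) : jet1 := x.1.

End Forms.

(* Main.v *)
Require Import Defs.
From mathcomp Require Import all_boot all_algebra.

Set Implicit Arguments.
Unset Strict Implicit.
Unset Printing Implicit Defensive.

Import GRing.Theory.
Local Open Scope ring_scope.

(** The proof separates the algebra of the actions from the question of where
    they land.

    Algebra. The formulas for the two actions make sense on the whole of
    A + Omega1 + Omega1 (x) Omega1, and there they already define a bimodule.
    With D2 = nabla o d and tau = id + sigma, this rests on tau being a
    bimodule map, on D2 being linear, and on the second order Leibniz rule
      D2 (a b) = (D2 a) b + tau (da (x) db) + a (D2 b),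
    which is the Leibniz rule of d followed by the two of nabla, the summand
    da (x) db of nabla (a db) joining the summand sigma (da (x) db) of
    nabla ((da) b). In degree two, this rule is what associativity of the
    actions on A says, and also what s |-> s + ds + D2 s being a bimodule map
    says. The components of degree at most one are those of the first jet
    bimodule.

    Landing in the kernel of the wedge product. Torsion freeness gives
    wedge (nabla da) = d d a = 0. It also gives wedge o tau = 0: comparing
    d (w a) = (dw) a - w /\ da with wedge (nabla (w a)) yields
    wedge (sigma (w (x) da)) = - w /\ da, so that wedge o tau vanishes on the
    tensors w (x) da, hence on all w (x) (da) b because tau is right A-linear.
    These suffice, as Omega1 is spanned by the forms (da) b
    ([Omega1_ind]), the DGA being generated by A and dA. The kernel is itself
    a sub-bimodule, so both actions and the prolongation restrict to
    A + Omega1 + Omega2S ([restrict_bimod]). *)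

(** * Restriction of a bimodule structure along an injection *)

Section Restriction.
Variables (k : fieldType) (A : algType k) (M N : lmodType k).
Variables (BM : bimodule A M) (f : N -> M).
Variables (l : A -> N -> N) (r : N -> A -> N).
Hypotheses (fl : linear f) (fi : injective f).
Hypothesis fL : forall a x, f (l a x) = lact BM a (f x).
Hypothesis fR : forall x a, f (r x a) = ract BM (f x) a.

(** Injectivity of f reduces each law for N to the same law for M. *)
Definition restrict_bimod : bimodule A N.
Proof.
exists l r.
- by move=> m c a b; apply: fi; rewrite fl !fL (lact_linearl BM).
- by move=> a c x y; apply: fi; rewrite fl !fL fl (lact_linearr BM).
- by move=> a c x y; apply: fi; rewrite fl !fR fl (ract_linearl BM).
- by move=> m c a b; apply: fi; rewrite fl !fR (ract_linearr BM).
- by move=> m; apply: fi; rewrite fL lact1.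
- by move=> m; apply: fi; rewrite fR ract1.
- by move=> a b m; apply: fi; rewrite !fL lactM.
- by move=> m a b; apply: fi; rewrite !fR ractM.
- by move=> a m b; apply: fi; rewrite !(fL, fR) lractA.
Defined.

End Restriction.

(** * Forms of degree one and the kernel of the wedge product *)

(* The actions on Omega11 stay folded under /=, so that the bimodule laws
   remain applicable after simplification. *)
Local Arguments lact : simpl never.
Local Arguments ract : simpl never.

Section Forms.
Variables (k : fieldType) (A : algType k) (Om : dga A).

Local Notation O1 := (Omega1 Om).
Local Notation O11 := (Omega11 Om).
Local Notation d := (d0 Om).
Local Notation l11 := (lact (Omega11_bimod Om)).
Local Notation r11 := (ract (Omega11_bimod Om)).
Local Notation wedge01 a x := (@wedge k A Om 0 2 a x).
Local Notation wedge20 x a := (@wedge k A Om 2 0 x a).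

(** Forms (da) b span Omega1. Their span is also stable under left
    multiplication, since c da = d (c a) - (dc) a, so that the graded subspace
    which is this span in degree one and everything in the other degrees is
    closed under products, contains A and dA, and hence is all of Omega. *)
Lemma Omega1_ind (P : O1 -> Prop) :
  (forall c x y, P x -> P y -> P (c *: x + y)) ->
  (forall a b, P (rmul1 (d a) b)) -> forall w, P w.
Proof.
move=> Plin Pgen w.
have P0 : P 0.
  (* 0 = (d 1) 0 is one of the generators *)
  by have := Pgen 1 0; rewrite d01 (lin0 (rmul1_linearl _)).
(* Closing P under both actions first makes products preserve it. *)
pose Q (x : O1) := forall a b, P (lmul1 a (rmul1 x b)).
suff : Q w by move/(_ 1 1); rewrite lmul11 rmul11.
pose S n : Defs.form Om n -> Prop :=
  match n return Defs.form Om n -> Prop with 1 => Q | _ => fun _ => True end.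
suff : forall n x, S n x by move=> /(_ 1%N w).
apply: (@form_generated k A Om S).
- case=> [|[|n]] //= a b.
  by rewrite (lin0 (rmul1_linearl _)) (lin0 (lmul1_linearr _)).
- case=> [|[|n]] //= c x y Qx Qy a b.
  by rewrite rmul1_linearl lmul1_linearr; apply: Plin.
- case=> [|[|m]] [|[|n]] //= x y Qx Qy a b.
    by rewrite -[wedge _ _]/(lmul1 x y) -lrmul1A -lmul1M; apply: Qy.
  by rewrite -[wedge _ _]/(rmul1 x y) -rmul1M; apply: Qx.
- move=> c; split=> // a b.
  rewrite -/(d c) (_ : lmul1 a _ =
    (-1) *: rmul1 (d a) (c * b) + rmul1 (d (a * c)) b).
    by apply: Plin.
  rewrite d0M (linD (rmul1_linearl _)) rmul1M lrmul1A scaleN1r.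
  by rewrite addrA addNr add0r.
Qed.

Lemma tens1_ind (P : O11 -> Prop) :
  P 0 -> (forall x y, P x -> P y -> P (x + y)) ->
  (forall w v, P (tens1 w v)) -> forall x, P x.
Proof.
move=> P0 PD Pt; elim/tsum_ind; elim=> [|p s IH]; first exact: P0.
by rewrite tsum_cons; apply: PD IH; apply: Pt.
Qed.

Lemma l11_tens (a : A) (w v : O1) : l11 a (tens1 w v) = tens1 (lmul1 a w) v.
Proof. exact: tlact_tens. Qed.

Lemma r11_tens (a : A) (w v : O1) : r11 (tens1 w v) a = tens1 w (rmul1 v a).
Proof. exact: tract_tens. Qed.

Lemma tens1_bal (w : O1) (a : A) (v : O1) :
  tens1 (rmul1 w a) v = tens1 w (lmul1 a v).
Proof. exact: (tens_bal (Omega1_bimod Om) (Omega1_bimod Om)). Qed.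

Lemma tens1_linearl v : linear (fun w : O1 => tens1 w v).
Proof. exact: tens_linearl. Qed.

Lemma tens1_linearr w : linear (@tens1 k A Om w).
Proof. exact: tens_linearr. Qed.

Lemma wedgeT_lact a x : wedgeT (l11 a x) = wedge01 a (wedgeT x).
Proof.
elim/tens1_ind: x => [|x y IHx IHy|w v].
- rewrite (lin0 (lact_linearr _ _)) (lin0 (@wedgeT_linear k A Om)).
  by rewrite (lin0 (@wedge_linearr k A Om 0 2 a)).
- rewrite (linD (lact_linearr _ _)) !(linD (@wedgeT_linear k A Om)).
  by rewrite (linD (@wedge_linearr k A Om 0 2 a)) IHx IHy.
- rewrite l11_tens !wedgeT_tens; have := @wedgeA k A Om 0 1 1 a w v.
  by rewrite (eq_irrelevance (addnA 0 1 1) erefl) => /esym.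
Qed.

Lemma wedgeT_ract x a : wedgeT (r11 x a) = wedge20 (wedgeT x) a.
Proof.
elim/tens1_ind: x => [|x y IHx IHy|w v].
- rewrite (lin0 (ract_linearl _ _)) (lin0 (@wedgeT_linear k A Om)).
  by rewrite (lin0 (@wedge_linearl k A Om 2 0 a)).
- rewrite (linD (ract_linearl _ _)) !(linD (@wedgeT_linear k A Om)).
  by rewrite (linD (@wedge_linearl k A Om 2 0 a)) IHx IHy.
- rewrite r11_tens !wedgeT_tens; have := @wedgeA k A Om 1 1 0 w v a.
  by rewrite (eq_irrelevance (addnA 1 1 0) erefl).
Qed.

Lemma d1_rmul (w : O1) (a : A) :
  d1 (rmul1 w a) = wedge20 (d1 w) a - wedge11 w (d a).
Proof.
have := @leibniz k A Om 1 0 w a.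
by rewrite (eq_irrelevance (addnS 1 0) erefl) expr1 scaleN1r.
Qed.

Lemma ker_wedge_lact a x :
  x \in @ker_wedge k A Om -> l11 a x \in @ker_wedge k A Om.
Proof.
rewrite !inE wedgeT_lact => /eqP->.
by rewrite (lin0 (@wedge_linearr k A Om 0 2 a)).
Qed.

Lemma ker_wedge_ract a x :
  x \in @ker_wedge k A Om -> r11 x a \in @ker_wedge k A Om.
Proof.
rewrite !inE wedgeT_ract => /eqP->.
by rewrite (lin0 (@wedge_linearl k A Om 2 0 a)).
Qed.

Lemma ker_wedgeD x y : x \in @ker_wedge k A Om -> y \in @ker_wedge k A Om ->
  x + y \in @ker_wedge k A Om.
Proof. exact: rpredD. Qed.

(** * The bimodule structure on A + Omega1 + Omega1 (x) Omega1 *)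

Section Prejet.
Variables (D2 : A -> O11) (tau : O11 -> O11).
Hypothesis D2_linear : linear D2.
Hypothesis tau_bimod_map : bimod_map (Omega11_bimod Om) (Omega11_bimod Om) tau.
Hypothesis D2M : forall a b,
  D2 (a * b) = r11 (D2 a) b + tau (tens1 (d a) (d b)) + l11 a (D2 b).

Let tau_linear : linear tau.
Proof. by case: tau_bimod_map. Qed.
Let tau_lact a x : tau (l11 a x) = l11 a (tau x).
Proof. by case: tau_bimod_map. Qed.
Let tau_ract x a : tau (r11 x a) = r11 (tau x) a.
Proof. by case: tau_bimod_map. Qed.

(** The ambient module of the second jets: the degree two part is not yet
    required to lie in the kernel of the wedge product. *)
Definition prejet : lmodType k := (A * O1 * O11)%type.

Definition prejet_lact (a : A) (x : prejet) : prejet :=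
  (jet1_lact a x.1,
   r11 (D2 a) x.1.1 + tau (tens1 (d a) x.1.2) + l11 a x.2).

Definition prejet_ract (x : prejet) (a : A) : prejet :=
  (jet1_ract x.1 a,
   l11 x.1.1 (D2 a) + tau (tens1 x.1.2 (d a)) + r11 x.2 a).

Lemma addrACA3 (V : zmodType) (x y z x' y' z' : V) :
  (x + x') + (y + y') + (z + z') = (x + y + z) + (x' + y' + z').
Proof. by rewrite [x + x' + _]addrACA [LHS]addrACA. Qed.

Lemma prejet_lact_linearl x : linear (prejet_lact^~ x).
Proof.
move=> c a b; congr pair; first exact: jet1_lact_linearl.
rewrite /= d0_linear D2_linear tens1_linearl tau_linear.
by rewrite (lact_linearl (Omega11_bimod Om)) (ract_linearl (Omega11_bimod Om))
  !addrACA3 -!scalerDr.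
Qed.

Lemma prejet_lact_linearr a : linear (prejet_lact a).
Proof.
move=> c x y; congr pair; first exact: jet1_lact_linearr.
rewrite /= tens1_linearr tau_linear.
by rewrite (lact_linearr (Omega11_bimod Om)) (ract_linearr (Omega11_bimod Om))
  !addrACA3 -!scalerDr.
Qed.

Lemma prejet_ract_linearl a : linear (prejet_ract^~ a).
Proof.
move=> c x y; congr pair; first exact: jet1_ract_linearl.
rewrite /= tens1_linearl tau_linear.
by rewrite (lact_linearl (Omega11_bimod Om)) (ract_linearl (Omega11_bimod Om))
  !addrACA3 -!scalerDr.
Qed.

Lemma prejet_ract_linearr x : linear (prejet_ract x).
Proof.
move=> c a b; congr pair; first exact: jet1_ract_linearr.
rewrite /= d0_linear D2_linear tens1_linearr tau_linear.
by rewrite (lact_linearr (Omega11_bimod Om)) (ract_linearr (Omega11_bimod Om))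
  !addrACA3 -!scalerDr.
Qed.

Let D21 : D2 1 = 0.
Proof.
have := D2M 1 1; rewrite mulr1 d01 (lin0 (tens1_linearl _)) (lin0 tau_linear).
by rewrite ract1 lact1 addr0 -{1}[D2 1]addr0 => /addrI.
Qed.

Lemma prejet_lact1 x : prejet_lact 1 x = x.
Proof.
case: x => x t; congr pair; first exact: jet1_lact1.
rewrite /= d01 D21 (lin0 (ract_linearl _ _)) (lin0 (tens1_linearl _)).
by rewrite (lin0 tau_linear) !add0r lact1.
Qed.

Lemma prejet_ract1 x : prejet_ract x 1 = x.
Proof.
case: x => x t; congr pair; first exact: jet1_ract1.
rewrite /= d01 D21 (lin0 (lact_linearr _ _)) (lin0 (tens1_linearr _)).
by rewrite (lin0 tau_linear) !add0r ract1.
Qed.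

(** In degree two, the terms containing the A component of x match by the second
    order Leibniz rule, multiplied by that component on the right. *)
Lemma prejet_lactM a b x :
  prejet_lact (a * b) x = prejet_lact a (prejet_lact b x).
Proof.
case: x => [[s w] t]; congr pair; first exact: jet1_lactM.
rewrite /= D2M !(linD (ract_linearl _ _)) d0M (linD (tens1_linearl _)).
rewrite (linD (tens1_linearr _)) !(linD tau_linear).
rewrite !(linD (lact_linearr _ _)) -ractM -tau_ract r11_tens tens1_bal.
rewrite -l11_tens tau_lact lactM lractA -!addrA; congr (_ + (_ + _)).
by rewrite addrCA.
Qed.

(** In degree two, the terms containing the A component of x match by the second
    order Leibniz rule, multiplied by that component on the left. *)
Lemma prejet_ractM x a b :
  prejet_ract x (a * b) = prejet_ract (prejet_ract x a) b.
Proof.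
case: x => [[s w] t]; congr pair; first exact: jet1_ractM.
rewrite /= D2M !(linD (lact_linearr _ _)) d0M (linD (tens1_linearl _)).
rewrite (linD (tens1_linearr _)) !(linD tau_linear).
rewrite !(linD (ract_linearl _ _)) -lactM -tau_lact l11_tens -tens1_bal.
rewrite -r11_tens tau_ract ractM lractA.
by rewrite [LHS](AC (3*2*1) ((3*(2*5))*(1*4*6))).
Qed.

(** The cross terms tau (da (x) s db) and tau ((da) s (x) db) agree by
    balancedness; left and right linearity of tau match the mixed terms in w. *)
Lemma prejet_lractA a x b :
  prejet_lact a (prejet_ract x b) = prejet_ract (prejet_lact a x) b.
Proof.
case: x => [[s w] t]; congr pair; first exact: jet1_lractA.
rewrite /= !(linD (tens1_linearl _)) !(linD (tens1_linearr _)).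
rewrite !(linD tau_linear) !(linD (ract_linearl _ _)).
rewrite !(linD (lact_linearr _ _)) -tau_ract -tau_lact.
rewrite l11_tens r11_tens -tens1_bal ractM lactM lractA.
by rewrite [LHS](AC (1*2*3) ((4*(2*5))*(1*3*6))).
Qed.

Definition prejet_bimod : bimodule A prejet :=
  Bimodule prejet_lact_linearl prejet_lact_linearr
    prejet_ract_linearl prejet_ract_linearr
    prejet_lact1 prejet_ract1 prejet_lactM prejet_ractM prejet_lractA.

(** Becomes the jet prolongation j^2 once D2 takes values in the kernel of the
    wedge product. *)
Definition prejet_prolong (s : A) : prejet := (s, d s, D2 s).

Lemma prejet_prolong_bimod_map :
  bimod_map (reg_bimod A) prejet_bimod prejet_prolong.
Proof.
split=> [c a b|a s|s a].
- by congr (_, _, _); [exact: d0_linear | exact: D2_linear].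
- by congr (_, _, _); [exact: d0M | exact: D2M].
- congr (_, _, _); first by rewrite /= d0M addrC.
  by rewrite /= D2M [LHS](ACl (3*2*1)).
Qed.

End Prejet.

(** * Torsion free bimodule connections *)

Section Connection.
Variable C : bimod_connection Om.
Local Notation nab := (nabla C).
Local Notation sig2 := (two_sigma C).

Lemma two_sigma_linear : linear sig2.
Proof.
have [sl _ _] := sigma_bimod_map C => c x y.
by rewrite /two_sigma sl scalerDr addrACA.
Qed.

Lemma two_sigma_lact a x : sig2 (l11 a x) = l11 a (sig2 x).
Proof.
have [_ sl _] := sigma_bimod_map C.
by rewrite /two_sigma sl (linD (lact_linearr _ _)).
Qed.

Lemma two_sigma_ract x a : sig2 (r11 x a) = r11 (sig2 x) a.
Proof.
have [_ _ sr] := sigma_bimod_map C.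
by rewrite /two_sigma sr (linD (ract_linearl _ _)).
Qed.

(** The two Leibniz rules of nabla, applied to d (a b) = (da) b + a db,
    contribute sigma (da (x) db) and da (x) db respectively; id + sigma
    appears as their sum. *)
Lemma nabla_d0M a b :
  nab (d (a * b)) =
  r11 (nab (d a)) b + sig2 (tens1 (d a) (d b)) + l11 a (nab (d b)).
Proof.
rewrite d0M linearD nabla_leibnizl nabla_leibnizr /two_sigma /= -!addrA.
by congr (_ + _); rewrite addrCA.
Qed.

Lemma nabla_d0_linear : linear (fun a => nab (d a)).
Proof. by move=> c a b; rewrite d0_linear linearP. Qed.

Lemma two_sigma_bimod_map :
  bimod_map (Omega11_bimod Om) (Omega11_bimod Om) sig2.
Proof.
by split; [exact: two_sigma_linear | exact: two_sigma_lact
  | move=> m a; exact: two_sigma_ract].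
Qed.

Hypothesis tfC : torsion_free C.

Lemma nabla_d0_ker a : nab (d a) \in @ker_wedge k A Om.
Proof. by rewrite inE tfC; apply/eqP; exact: (@ext_dd k A Om 0 a). Qed.

(** Torsion freeness ties sigma to the sign in d (w a) = (dw) a - w /\ da, which
    gives the case of an exact right factor; right linearity of id + sigma
    does the rest. *)
Lemma two_sigma_tens_ker w v : sig2 (tens1 w v) \in @ker_wedge k A Om.
Proof.
elim/Omega1_ind: v => [c x y Px Py|a b].
  rewrite tens1_linearr two_sigma_linear.
  exact: (proj2 (@ker_wedge_submod k A Om)).
rewrite -r11_tens two_sigma_ract; apply: ker_wedge_ract.
have := tfC (rmul1 w a).
rewrite nabla_leibnizr (linD (@wedgeT_linear k A Om)) wedgeT_ract tfC d1_rmul.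
(* cancelling (dw) a leaves wedge (sigma (w (x) da)) = - w /\ da *)
move/addrI; rewrite inE (linD (@wedgeT_linear k A Om)) wedgeT_tens => ->.
by rewrite addrN.
Qed.

End Connection.

(** * Second jets inside the ambient module *)

Definition is_jet2 (x : prejet) := x.2 \in @ker_wedge k A Om.

Definition jet2_of (x : prejet) (Kx : is_jet2 x) : jet2 Om :=
  (x.1, Sub x.2 Kx).

Lemma jet2_ofK x Kx : jet2_ambient (@jet2_of x Kx) = x.
Proof. by case: x Kx => [[s w] t] Kx; rewrite /jet2_ambient SubK. Qed.

Lemma jet2_ambient_ker x : is_jet2 (jet2_ambient x).
Proof. exact: valP. Qed.

Lemma jet2_ambient_inj : injective (@jet2_ambient k A Om).
Proof. by case=> [[s w] t] [[s' w'] t'] [-> -> /val_inj->]. Qed.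

Lemma jet2_ambient_linear : linear (@jet2_ambient k A Om).
Proof. by move=> c x y; congr (_, _, _); exact: linearP. Qed.

End Forms.

Theorem proposition3p1 (k : fieldType) (A : algType k) (Om : dga A)
    (C : bimod_connection Om) (tfC : torsion_free C) :
  exists (B2 : bimodule A (jet2 Om)) (j2 : A -> jet2 Om),
    [/\ (forall a s : A,
           jet2_ambient (lact B2 a (jet2_A Om s)) =
             (a * s, rmul1 (d0 Om a) s,
              ract (Omega11_bimod Om) (nabla C (d0 Om a)) s)),
        (forall s a : A,
           jet2_ambient (ract B2 (jet2_A Om s) a) =
             (s * a, lmul1 s (d0 Om a),
              lact (Omega11_bimod Om) s (nabla C (d0 Om a)))),
        (forall (a : A) (w : Omega1 Om),
           jet2_ambient (lact B2 a (jet2_Omega1 w)) =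
             (0, lmul1 a w, two_sigma C (tens1 (d0 Om a) w)))
      & (forall (w : Omega1 Om) (a : A),
           jet2_ambient (ract B2 (jet2_Omega1 w) a) =
             (0, rmul1 w a, two_sigma C (tens1 w (d0 Om a))))]
    /\ [/\ (forall (a : A) (t : Omega2S Om),
              jet2_ambient (lact B2 a (jet2_Omega2S t)) =
                (0, 0, lact (Omega11_bimod Om) a (val t))),
           (forall (t : Omega2S Om) (a : A),
              jet2_ambient (ract B2 (jet2_Omega2S t) a) =
                (0, 0, ract (Omega11_bimod Om) (val t) a))
         & (forall s : A,
              jet2_ambient (j2 s) = (s, d0 Om s, nabla C (d0 Om s)))]
    /\ [/\ bimod_map (reg_bimod A) B2 j2,
           bimod_map B2 (jet1_bimod Om) (@pi2 k A Om),
           (forall y : jet1 Om, exists x : jet2 Om, pi2 x = y)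
         & (forall s : A, pi2 (j2 s) = j1 Om s)].
Proof.
pose BP := prejet_bimod (nabla_d0_linear C) (two_sigma_bimod_map C)
  (nabla_d0M C).
(* Each action contributes three terms in degree two, all in the kernel. *)
have kerL a x : is_jet2 x -> is_jet2 (lact BP a x).
  move=> Kx; apply: ker_wedgeD; last exact: ker_wedge_lact.
  by apply: ker_wedgeD; [exact/ker_wedge_ract/nabla_d0_ker
    | exact: two_sigma_tens_ker].
have kerR x a : is_jet2 x -> is_jet2 (ract BP x a).
  move=> Kx; apply: ker_wedgeD; last exact: ker_wedge_ract.
  by apply: ker_wedgeD; [exact/ker_wedge_lact/nabla_d0_ker
    | exact: two_sigma_tens_ker].
pose l a x := jet2_of (kerL a _ (jet2_ambient_ker x)).
pose r x a := jet2_of (kerR _ a (jet2_ambient_ker x)).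
have lE a x : jet2_ambient (l a x) = lact BP a (jet2_ambient x).
  exact: jet2_ofK.
have rE x a : jet2_ambient (r x a) = ract BP (jet2_ambient x) a.
  exact: jet2_ofK.
pose B2 := restrict_bimod (@jet2_ambient_linear k A Om)
  (@jet2_ambient_inj k A Om) lE rE.
pose j2 a : jet2 Om :=
  @jet2_of k A Om (prejet_prolong (fun a => nabla C (d0 Om a)) a)
    (nabla_d0_ker tfC a).
have j2E a : jet2_ambient (j2 a) = (a, d0 Om a, nabla C (d0 Om a)).
  exact: jet2_ofK.
have l11l x := lin0 (lact_linearl (Omega11_bimod Om) x).
have l11r a := lin0 (lact_linearr (Omega11_bimod Om) a).
have r11l a := lin0 (ract_linearl (Omega11_bimod Om) a).
have r11r x := lin0 (ract_linearr (Omega11_bimod Om) x).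
have l1l (x : Omega1 Om) := lin0 (lmul1_linearl x).
have l1r a := lin0 (@lmul1_linearr k A Om a).
have r1l a := lin0 (@rmul1_linearl k A Om a).
have r1r (x : Omega1 Om) := lin0 (rmul1_linearr x).
have tl (x : Omega1 Om) := lin0 (tens1_linearl x).
have tr (x : Omega1 Om) := lin0 (tens1_linearr x).
have s20 := lin0 (two_sigma_linear C).
have val0 : val (0 : Omega2S Om) = 0 by exact: raddf0.
(* The actions on a single summand are the general ones with zeros elsewhere. *)
pose zeros := (mulr0, mul0r, l11l, l11r, r11l, r11r, l1l, l1r, r1l, r1r, tl, tr,
  s20, val0, addr0, add0r).
exists B2, j2; split; first split.
- by move=> a s; rewrite lE; congr (_, _, _); rewrite /= !zeros.
- by move=> s a; rewrite rE; congr (_, _, _); rewrite /= !zeros.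
- by move=> a w; rewrite lE; congr (_, _, _); rewrite /= !zeros.
- by move=> w a; rewrite rE; congr (_, _, _); rewrite /= !zeros.
split; split=> //.
- by move=> a t; rewrite lE; congr (_, _, _); rewrite /= !zeros.
- by move=> t a; rewrite rE; congr (_, _, _); rewrite /= !zeros.
- have [jlin jL jR] := prejet_prolong_bimod_map (nabla_d0_linear C)
    (two_sigma_bimod_map C) (nabla_d0M C).
  split=> [c a b|a s|s a]; apply: (@jet2_ambient_inj k A Om).
  + by rewrite jet2_ambient_linear !j2E; exact: jlin.
  + by rewrite lE !j2E; exact: jL.
  + by rewrite rE !j2E; exact: jR.
- by move=> y; exists (y, 0).
Qed.
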